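(* Let $(\Omega,\mathcal{A})$ be a measurable space, $\mu$ a finite nonnegative measure on $(\Omega,\mathcal{A})$, $(\mathcal{X},d_{\mathcal{X}})$ a metric space, and $\mathcal{H}$ a $\mathbb{K}$-Hilbert space. Furthermore, let $\Phi:\mathcal{X}\times\Omega\to\mathcal{H}$ be such that $\Phi(x,\cdot)\in\mathcal{L}^2(\Omega,\mathcal{A},\mu,\mathcal{H})$ for all $x\in\mathcal{X}$. Finally, assume that there exist $\alpha,L_\Phi\in\mathbb{R}_{>0}$ such that for $\mu$-almost all $\omega\in\Omega$, $\Phi(\cdot,\omega)$ is $\alpha$-H\''older continuous with H\''older constant $L_\Phi$. Then $$k(x,x')=\int_\Omega\langle\Phi(x',\omega),\Phi(x,\omega)\rangle_{\mathcal{H}}\,\mathrm{d}\mu(\omega)$$ is a well-defined kernel on $\mathcal{X}$, and all $f\in H_k$ are $\alpha$-H\''older continuous with H\''older constant $L_\Phi\sqrt{\mu(\Omega)}\,\|f\|_k$.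
   Context: $\mathbb{K}$ denotes $\mathbb{R}$ or $\mathbb{C}$, and $\mathcal{X}$ is non-empty. $\mathcal{L}^2(\Omega,\mathcal{A},\mu,\mathcal{H})$ denotes the space of square-integrable measurable functions $\Omega\to\mathcal{H}$. A kernel on $\mathcal{X}$ is a positive semidefinite function $k:\mathcal{X}\times\mathcal{X}\to\mathbb{K}$, equivalently one of the form $k(x,x')=\langle\Psi(x'),\Psi(x)\rangle$ for some map $\Psi$ from $\mathcal{X}$ into a $\mathbb{K}$-Hilbert space. $H_k$, with norm $\|\cdot\|_k$, is the RKHS of $k$: the unique Hilbert space of functions $\mathcal{X}\to\mathbb{K}$ with $k(\cdot,x)\in H_k$ and $f(x)=\langle f,k(\cdot,x)\rangle_k$ for all $f\in H_k$, $x\in\mathcal{X}$. A map $g$ from $\mathcal{X}$ to a normed space is $\alpha$-H\''older continuous with H\''older constant $L\geq0$ if $\|g(x)-g(x')\|\leq L\,d_{\mathcal{X}}(x,x')^\alpha$ for all $x,x'\in\mathcal{X}$. *)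

(* Defs.v *)
From HB Require Import structures.
From mathcomp Require Import all_boot all_order all_algebra sesquilinear.
From mathcomp Require Import all_classical all_reals all_analysis.
From mathcomp Require Import complex.

Set Implicit Arguments.
Unset Strict Implicit.
Unset Printing Implicit Defensive.

Import Order.TTheory GRing.Theory Num.Theory.
Import numFieldTopology.Exports numFieldNormedType.Exports.

Local Open Scope classical_set_scope.
Local Open Scope ring_scope.

Variant scalar_kind := RealScalars | ComplexScalars.

(* The field K, i.e. R or R[i].  The library's order on R[i] is the partial one
   in which 0 <= z means that z is real and nonnegative, and norms of vectors
   over R[i] take their values in R[i]. *)
Definition scalars (R : realType) (s : scalar_kind) : numFieldType :=
  match s with RealScalars => R | ComplexScalars => R[i] end.

Definition scalar_re (R : realType) (s : scalar_kind) : scalars R s -> R :=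
  match s with RealScalars => id | ComplexScalars => @complex.Re R end.

Definition scalar_im (R : realType) (s : scalar_kind) : scalars R s -> R :=
  match s with RealScalars => fun=> 0 | ComplexScalars => @complex.Im R end.

Definition scalar_conj (R : realType) (s : scalar_kind) :
    scalars R s -> scalars R s :=
  match s with RealScalars => id | ComplexScalars => @conjc R end.

(* The norm, seen as an element of R. *)
Definition rnorm (R : realType) (s : scalar_kind)
    (V : normedModType (scalars R s)) (v : V) : R := scalar_re `|v|.

(* The inner product is linear in its first argument and conjugate-linear in
   the second. *)
HB.mixin Record NormedModule_isHilbert (R : realType) (s : scalar_kind) H
    of CompleteNormedModule (scalars R s) H := {
  hdot : {dot H for @scalar_conj R s};
  hdot_normE : forall u : H, hdot u u = `|u| ^+ 2
}.

#[short(type="hilbertType")]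
HB.structure Definition Hilbert (R : realType) (s : scalar_kind) :=
  {H of CompleteNormedModule (scalars R s) H & NormedModule_isHilbert R s H}.

Section scalar_integral.
Context (d : measure_display) (Omega : measurableType d) (R : realType).
Variable mu : {measure set Omega -> \bar R}.

Definition scalar_integrable (s : scalar_kind) (f : Omega -> scalars R s) :=
  mu.-integrable setT (fun w => (scalar_re (f w))%:E) /\
  mu.-integrable setT (fun w => (scalar_im (f w))%:E).

Definition scalar_integral (s : scalar_kind) :
    (Omega -> scalars R s) -> scalars R s :=
  match s with
  | RealScalars => fun f => \int[mu]_w f w
  | ComplexScalars => fun f =>
      Complex (\int[mu]_w complex.Re (f w)) (\int[mu]_w complex.Im (f w))
  end.

End scalar_integral.

Section square_integrable.
Context (d : measure_display) (Omega : measurableType d) (R : realType).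
Context (s : scalar_kind) (H : normedModType (scalars R s)).

(* Measurability of a vector-valued function in the sense of Bochner: pointwise
   limit of measurable step functions.  It coincides with Borel measurability
   when H is separable; when it is not, Borel measurability of f and g does not
   make w |-> <f w, g w> measurable. *)
Definition vector_measurable (f : Omega -> H) :=
  exists2 h : nat -> {fimfun Omega >-> H},
    (forall n y, measurable (h n @^-1` [set y])) &
    (forall w, h n w @[n --> \oo] --> f w).

Definition square_integrable (mu : {measure set Omega -> \bar R})
    (f : Omega -> H) :=
  vector_measurable f /\ (\int[mu]_w ((rnorm (f w) ^+ 2)%:E) < +oo)%E.

End square_integrable.

Definition hoelder_continuous (R : realType) (s : scalar_kind)
    (X : metricType R) (V : normedModType (scalars R s)) (alpha L : R)
    (g : X -> V) :=
  forall x x', rnorm (g x - g x') <= L * (mdist x x') `^ alpha.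

(* Positive semidefinite functions; over R the symmetry requirement is not
   implied by the second condition. *)
Definition is_kernel (R : realType) (s : scalar_kind) (X : Type)
    (k : X -> X -> scalars R s) :=
  (forall x x', k x x' = scalar_conj (k x' x)) /\
  (forall (n : nat) (x : 'I_n -> X) (c : 'I_n -> scalars R s),
     0 <= \sum_(i < n) \sum_(j < n) scalar_conj (c i) * c j * k (x i) (x j)).

(* A Hilbert space of functions X -> K is a Hilbert space together with an
   injective linear evaluation map into X -> K. *)
Record rkhs (R : realType) (s : scalar_kind) (X : Type)
    (k : X -> X -> scalars R s) := Rkhs {
  rkhs_space :> hilbertType R s;
  rkhs_fun : rkhs_space -> X -> scalars R s;
  rkhs_linear : forall a f g x,
    rkhs_fun (a *: f + g) x = a * rkhs_fun f x + rkhs_fun g x;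
  rkhs_inj : injective rkhs_fun;
  rkhs_reproducing : forall x, exists2 kx : rkhs_space,
    rkhs_fun kx = k ^~ x & forall f, rkhs_fun f x = hdot f kx
}.

Definition feature_kernel (d : measure_display) (Omega : measurableType d)
    (R : realType) (s : scalar_kind) (mu : {measure set Omega -> \bar R})
    (X : Type) (H : hilbertType R s) (Phi : X -> Omega -> H) (x x' : X) :
    scalars R s :=
  scalar_integral mu (fun w => hdot (Phi x' w) (Phi x w)).

(* Main.v *)
Require Import Defs.
From HB Require Import structures.
From mathcomp Require Import all_boot all_order all_algebra sesquilinear.
From mathcomp Require Import all_classical all_reals all_analysis.
From mathcomp Require Import measurable_realfun complex ring lra.

Set Implicit Arguments.
Unset Strict Implicit.
Unset Printing Implicit Defensive.

Import Order.TTheory GRing.Theory Num.Theory.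
Import numFieldTopology.Exports numFieldNormedType.Exports.

Local Open Scope classical_set_scope.
Local Open Scope ring_scope.

(** For [x] and [x'] in [X], the vector [e = k(.,x) - k(.,x')] of [H_k] satisfies
    [f x - f x' = <f, e>] for all [f] in [H_k], so by the Cauchy-Schwarz inequality
    [|f x - f x'| <= |f| |e|].  The reproducing property and the bilinearity of
    the integral give
      [|e|^2 = k(x,x) - k(x,x') - k(x',x) + k(x',x')
             = \int |Phi x w - Phi x' w|^2 d mu(w)]
    ([rkhs_section_dist]), and the integrand is almost everywhere at most the
    constant [(LPhi d(x,x')^alpha)^2], so that
    [|e| <= LPhi sqrt(mu(Omega)) d(x,x')^alpha].

    The integrals exist because of [|<u, v>| <= |u|^2 + |v|^2]; the measurability
    of [w |-> <f w, g w>] comes from approximating [f] and [g] by functions with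
    finitely many values and from polarization, which makes the inner product a
    continuous function of norms.  Positive semidefiniteness holds since
    [\sum_ij conj(c_i) c_j k(x_i,x_j)] is the integral of
    [|\sum_i c_i Phi(x_i,w)|^2].

    The real and the complex case are treated together: an element of [K] is
    determined by its real and imaginary parts, and [R] is embedded in [K] by
    [scalar_real]. *)

(** * Real and imaginary parts of scalars *)

Section Scalars.
Variables (R : realType) (s : scalar_kind).
Implicit Types (z c : scalars R s) (a b : R).

Lemma scalar_eqP z c :
  scalar_re z = scalar_re c -> scalar_im z = scalar_im c -> z = c.
Proof. by case: s z c => //= -[a b] [a' b'] /= -> ->. Qed.

Lemma scalar_reD z c : scalar_re (z + c) = scalar_re z + scalar_re c.
Proof. by case: s z c => //= -[a b] [a' b']. Qed.

Lemma scalar_imD z c : scalar_im (z + c) = scalar_im z + scalar_im c.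
Proof. by case: s z c => [z c|[a b] [a' b']] //=; rewrite addr0. Qed.

Lemma scalar_reM z c : scalar_re (z * c) =
  scalar_re z * scalar_re c - scalar_im z * scalar_im c.
Proof. by case: s z c => [z c|[a b] [a' b']] //=; rewrite mulr0 subr0. Qed.

Lemma scalar_imM z c : scalar_im (z * c) =
  scalar_re z * scalar_im c + scalar_im z * scalar_re c.
Proof. by case: s z c => [z c|[a b] [a' b']] //=; rewrite mulr0 mul0r addr0. Qed.

Lemma scalar_reB z c : scalar_re (z - c) = scalar_re z - scalar_re c.
Proof. by rewrite -[in RHS](subrK c z) (scalar_reD (z - c)) addrK. Qed.

Lemma scalar_re0 : scalar_re (0 : scalars R s) = 0.
Proof. by case: s. Qed.

Lemma scalar_im0 : scalar_im (0 : scalars R s) = 0.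
Proof. by case: s. Qed.

Lemma scalar_re_conj z : scalar_re (scalar_conj z) = scalar_re z.
Proof. by case: s z => // -[a b]. Qed.

Lemma scalar_im_conj z : scalar_im (scalar_conj z) = - scalar_im z.
Proof. by case: s z => [z|[a b]] //=; rewrite oppr0. Qed.

Lemma mul_scalar_conj z : z * scalar_conj z = `|z| ^+ 2.
Proof.
case: s z => [z|z] /=; last by rewrite sqr_normc.
by rewrite real_normK ?num_real// expr2.
Qed.

Lemma scalar_ge0P z : 0 <= z <-> scalar_im z = 0 /\ 0 <= scalar_re z.
Proof.
case: s z => [z|[a b]] /=; first by split=> [|[]].
by rewrite lecE /=; split=> [/andP[/eqP]|[-> ->]] //; rewrite eqxx.
Qed.

(** The embedding of [R] into [K], which is the identity when [K] is [R]. *)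
Definition scalar_real : R -> scalars R s :=
  match s with RealScalars => id | ComplexScalars => fun r => Complex r 0 end.

Lemma scalar_re_real a : scalar_re (scalar_real a) = a.
Proof. by rewrite /scalar_real; case: s. Qed.

Lemma scalar_im_real a : scalar_im (scalar_real a) = 0.
Proof. by rewrite /scalar_real; case: s. Qed.

Lemma ler_scalar_real a b : (scalar_real a <= scalar_real b) = (a <= b).
Proof. by rewrite /scalar_real; case: s => //; exact: lecR. Qed.

Lemma ltr_scalar_real a b : (scalar_real a < scalar_real b) = (a < b).
Proof. by rewrite /scalar_real; case: s => //; exact: ltcR. Qed.

Lemma scalar_realD a b : scalar_real (a + b) = scalar_real a + scalar_real b.
Proof.
by apply: scalar_eqP; rewrite ?scalar_reD ?scalar_imD
  ?scalar_re_real ?scalar_im_real ?addr0.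
Qed.

Lemma scalar_realM a b : scalar_real (a * b) = scalar_real a * scalar_real b.
Proof.
apply: scalar_eqP;
  rewrite ?scalar_reM ?scalar_imM ?scalar_re_real ?scalar_im_real.
  by rewrite mulr0 subr0.
by rewrite mulr0 mul0r addr0.
Qed.

(** The imaginary part is the real part after multiplication by the conjugate
    of a fixed scalar: [c] is the imaginary unit if [K] is complex, and [0] if
    [K] is real. *)
Lemma scalar_im_reM :
  exists c, forall z, scalar_im z = scalar_re (scalar_conj c * z).
Proof.
case: s => [|]; first by exists 0 => z /=; rewrite mul0r.
by exists (Complex 0 1) => -[a b] /=; rewrite mul0r sub0r mulN1r opprK.
Qed.

Lemma ge0_scalar_realE z : 0 <= z -> scalar_real (scalar_re z) = z.
Proof.
move=> /scalar_ge0P[z0 _].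
by apply: scalar_eqP; rewrite ?scalar_re_real ?scalar_im_real.
Qed.

End Scalars.

(** * The real-valued norm *)

Section Rnorm.
Variables (R : realType) (s : scalar_kind) (V : normedModType (scalars R s)).
Implicit Types u v : V.

Lemma rnormE v : scalar_real s (rnorm v) = `|v|.
Proof. exact: ge0_scalar_realE. Qed.

Lemma rnorm_ge0 v : 0 <= rnorm v.
Proof. by have /scalar_ge0P[] := normr_ge0 v. Qed.

Lemma ler_rnormD u v : rnorm (u + v) <= rnorm u + rnorm v.
Proof. by rewrite -(@ler_scalar_real _ s) scalar_realD !rnormE ler_normD. Qed.

Lemma rnorm_dist u v : `|rnorm u - rnorm v| <= rnorm (u - v).
Proof.
have := ler_rnormD (u - v) v; have := ler_rnormD (v - u) u.
have -> : rnorm (v - u) = rnorm (u - v) by rewrite /rnorm distrC.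
rewrite !subrK ler_norml; lra.
Qed.

Lemma cvg_rnorm (u_ : nat -> V) u :
  u_ n @[n --> \oo] --> u -> rnorm (u_ n) @[n --> \oo] --> rnorm u.
Proof.
move=> /cvgrPdist_lt uu; apply/cvgrPdist_lt => e e0.
have e0' : 0 < scalar_real s e.
  rewrite (_ : 0 = scalar_real s 0) ?ltr_scalar_real//.
  by apply: scalar_eqP;
    rewrite ?scalar_re_real ?scalar_im_real ?scalar_re0 ?scalar_im0.
apply: filterS (uu _ e0') => n.
rewrite -rnormE ltr_scalar_real; apply: le_lt_trans.
exact: rnorm_dist.
Qed.

End Rnorm.

(** * Inner products *)

Section Hdot.
Variables (R : realType) (s : scalar_kind) (H : hilbertType R s).
Implicit Types u v w : H.

Lemma hdotC u v : hdot u v = scalar_conj (hdot v u).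
Proof.
by have := @hermitian_subproof _ _ _ _ hdot u v; rewrite expr0 mul1r.
Qed.

Lemma hdotBl u v w : hdot (u - v) w = hdot u w - hdot v w.
Proof. exact: linearBl. Qed.
Lemma hdotDl u v w : hdot (u + v) w = hdot u w + hdot v w.
Proof. exact: linearDl. Qed.

Lemma hdotBr u v w : hdot w (u - v) = hdot w u - hdot w v.
Proof. exact: linearBr. Qed.
Lemma hdotDr u v w : hdot w (u + v) = hdot w u + hdot w v.
Proof. exact: linearDr. Qed.

Lemma hdotZl c u v : hdot (c *: u) v = c * hdot u v.
Proof. exact: linearZl_LR. Qed.

Lemma hdotZr c u v : hdot u (c *: v) = scalar_conj c * hdot u v.
Proof. exact: linearZr_LR. Qed.

Lemma hdot_suml (I : Type) (r : seq I) (F : I -> H) v :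
  hdot (\sum_(i <- r) F i) v = \sum_(i <- r) hdot (F i) v.
Proof. exact: linear_sumlz. Qed.

Lemma hdot_sumr (I : Type) (r : seq I) (F : I -> H) v :
  hdot v (\sum_(i <- r) F i) = \sum_(i <- r) hdot v (F i).
Proof. exact: linear_sumr. Qed.

Lemma scalar_re_hdotE u : scalar_re (hdot u u) = rnorm u ^+ 2.
Proof.
by rewrite hdot_normE -rnormE expr2 -scalar_realM scalar_re_real expr2.
Qed.

Lemma hdot_CauchySchwarz u v :
  rnorm (hdot u v : (scalars R s)^o) <= rnorm u * rnorm v.
Proof.
rewrite -(@ler_scalar_real _ s) scalar_realM !rnormE.
change (`|hdot u v| <= `|u| * `|v|).
have [->|v0] := eqVneq v 0; first by rewrite linear0r !normr0 mulr0.
have nv : 0 < `|v| ^+ 2 by rewrite exprn_gt0// normr_gt0.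
have nvC : scalar_conj (`|v| ^+ 2) = `|v| ^+ 2 :> scalars R s.
  by rewrite -hdot_normE -hdotC.
(* Expand the squared norm of |v|^2 u - <u, v> v, which is |v|^2 times the
   difference of the two squared sides. *)
have := exprn_ge0 2 (normr_ge0 (`|v| ^+ 2 *: u - hdot u v *: v)).
rewrite -hdot_normE hdotBl !hdotBr !hdotZl !hdotZr !hdot_normE nvC.
rewrite (hdotC v u).
have E := mul_scalar_conj (hdot u v).
rewrite [X in 0 <= X -> _](_ : _ =
  `|v| ^+ 2 * ((`|u| * `|v|) ^+ 2 - `|hdot u v| ^+ 2)); last first.
  by rewrite -E; ring.
rewrite pmulr_rge0// subr_ge0 ler_pXn2r// nnegrE//; exact: mulr_ge0.
Qed.

(** Polarization: the real part of the inner product is a continuous function of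
    norms. *)
Lemma scalar_re_hdot_polar u v :
  scalar_re (hdot u v) = (rnorm (u + v) ^+ 2 - rnorm (u - v) ^+ 2) / 4.
Proof.
rewrite -!scalar_re_hdotE hdotBl !hdotBr hdotDl !hdotDr (hdotC v u).
rewrite !(scalar_reB, scalar_reD) scalar_re_conj; lra.
Qed.

(** Dominates an inner product by an integrable function; the missing factor
    [1/2] is immaterial. *)
Lemma ler_rnorm_hdot (u v : H) :
  rnorm (hdot u v : (scalars R s)^o) <= rnorm u ^+ 2 + rnorm v ^+ 2.
Proof.
apply: le_trans (hdot_CauchySchwarz u v) _.
have := sqr_ge0 (rnorm u - rnorm v).
have := sqr_ge0 (rnorm u + rnorm v); nra.
Qed.

Lemma ler_norm_scalar_re z : `|scalar_re z| <= rnorm (z : (scalars R s)^o).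
Proof.
case: s z => [z|[a b]] //=.
change (`|a| <= complex.Re `|Complex a b|).
by rewrite normc_def /= -sqrtr_sqr ler_wsqrtr// lerDl sqr_ge0.
Qed.

Lemma ler_norm_scalar_im z : `|scalar_im z| <= rnorm (z : (scalars R s)^o).
Proof.
case: s z => [z|[a b]] //=; first by rewrite normr0; exact: normr_ge0.
change (`|b| <= complex.Re `|Complex a b|).
by rewrite normc_def /= -[leLHS]sqrtr_sqr ler_wsqrtr// lerDr sqr_ge0.
Qed.

End Hdot.

(** * Measurability and integrability of inner products *)

Section Measurability.
Context (d : measure_display) (Omega : measurableType d) (R : realType).
Context (s : scalar_kind) (H : hilbertType R s).

(** An arbitrary function, without any continuity or measurability, of two
    functions with finitely many values and measurable level sets is measurable. *)
Lemma measurable_fimfun2 (V : zmodType) (f g : {fimfun Omega >-> V})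
    (phi : V -> V -> R) :
  (forall y, measurable (f @^-1` [set y])) ->
  (forall y, measurable (g @^-1` [set y])) ->
  measurable_fun setT (fun w => phi (f w) (g w)).
Proof.
move=> mf mg _ Y _; rewrite setTI.
rewrite (_ : _ @^-1` Y = \bigcup_(p in (range f `*` range g) `&`
    [set p | Y (phi p.1 p.2)]) (f @^-1` [set p.1] `&` g @^-1` [set p.2])).
  apply: fin_bigcup_measurable.
    by apply/finite_setIl/finite_setX; exact: fimfunP.
  by move=> p _; exact: measurableI.
apply/seteqP; split=> [w Yw | w [p [_ /= Yp] [/= -> ->]]]//.
by exists (f w, g w) => //; split=> //; split; exists w.
Qed.

(** The scalar [c] makes this cover both the real and the imaginary part, by
    [scalar_im_reM]. *)
Lemma measurable_scalar_re_hdotZ (c : scalars R s) (f g : Omega -> H) :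
  vector_measurable f -> vector_measurable g ->
  measurable_fun setT (fun w => scalar_re (hdot (f w) (c *: g w))).
Proof.
move=> [f_ mf ff] [g_ mg gg].
apply: (measurable_fun_cvg (D := setT) (h :=
  fun n w => scalar_re (hdot (f_ n w) (c *: g_ n w)))) => [n|w _].
  by apply: (@measurable_fimfun2 _ _ _
    (fun u v => scalar_re (hdot u (c *: v)))).
have cg : c *: g_ n w @[n --> \oo] --> c *: g w by apply: cvgZr; exact: gg.
rewrite scalar_re_hdot_polar; under eq_fun do rewrite scalar_re_hdot_polar.
apply: cvgM; last exact: cvg_cst.
apply: cvgB; rewrite expr2; under eq_fun do rewrite expr2.
  have fg : rnorm (f_ n w + c *: g_ n w) @[n --> \oo] -->
      rnorm (f w + c *: g w).
    by apply: cvg_rnorm; exact: (cvgD (ff w) cg).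
  exact: (cvgM fg fg).
have fg : rnorm (f_ n w - c *: g_ n w) @[n --> \oo] --> rnorm (f w - c *: g w).
  by apply: cvg_rnorm; exact: (cvgB (ff w) cg).
exact: (cvgM fg fg).
Qed.

Lemma measurable_scalar_re_hdot (f g : Omega -> H) :
  vector_measurable f -> vector_measurable g ->
  measurable_fun setT (fun w => scalar_re (hdot (f w) (g w))).
Proof.
move=> mf mg; have := measurable_scalar_re_hdotZ 1 mf mg.
by under eq_fun do rewrite scale1r.
Qed.

Lemma measurable_scalar_im_hdot (f g : Omega -> H) :
  vector_measurable f -> vector_measurable g ->
  measurable_fun setT (fun w => scalar_im (hdot (f w) (g w))).
Proof.
move=> mf mg; have [c cE] := scalar_im_reM R s.
have := measurable_scalar_re_hdotZ c mf mg.
by under eq_fun do rewrite hdotZr -cE.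
Qed.

Variable mu : {measure set Omega -> \bar R}.

Lemma square_integrable_rnorm2 (f : Omega -> H) : square_integrable mu f ->
  mu.-integrable setT (fun w => (rnorm (f w) ^+ 2)%:E).
Proof.
move=> [mf foo]; apply/integrableP; split.
  apply/measurable_EFinP; have := measurable_scalar_re_hdot mf mf.
  by under eq_fun do rewrite scalar_re_hdotE.
by under eq_integral do rewrite abse_EFin ger0_norm ?sqr_ge0//.
Qed.

Lemma scalar_integrable_hdot (f g : Omega -> H) :
  square_integrable mu f -> square_integrable mu g ->
  scalar_integrable mu (fun w => hdot (f w) (g w)).
Proof.
move=> L2f L2g.
have dom := integrableD measurableT (square_integrable_rnorm2 L2f)
  (square_integrable_rnorm2 L2g).
have [[mf _] [mg _]] := (L2f, L2g).
split; apply: le_integrable dom => //.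
- exact/measurable_EFinP/measurable_scalar_re_hdot.
- move=> w _; rewrite -EFinD !abse_EFin lee_fin.
  rewrite [leRHS]ger0_norm ?addr_ge0 ?sqr_ge0//.
  exact: le_trans (ler_norm_scalar_re _) (ler_rnorm_hdot _ _).
- exact/measurable_EFinP/measurable_scalar_im_hdot.
- move=> w _; rewrite -EFinD !abse_EFin lee_fin.
  rewrite [leRHS]ger0_norm ?addr_ge0 ?sqr_ge0//.
  exact: le_trans (ler_norm_scalar_im _) (ler_rnorm_hdot _ _).
Qed.

End Measurability.

(** * Linearity and positivity of the scalar-valued integral *)

Section ScalarIntegral.
Context (d : measure_display) (Omega : measurableType d) (R : realType).
Context (mu : {measure set Omega -> \bar R}) (s : scalar_kind).
Implicit Types f g : Omega -> scalars R s.

Lemma scalar_re_integral f :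
  scalar_re (scalar_integral mu f) = \int[mu]_w scalar_re (f w).
Proof. by case: s f. Qed.

Lemma scalar_im_integral f :
  scalar_im (scalar_integral mu f) = \int[mu]_w scalar_im (f w).
Proof. by case: s f => // f /=; rewrite Rintegral_cst// mul0r. Qed.

Lemma scalar_integrableD f g :
  scalar_integrable mu f -> scalar_integrable mu g ->
  scalar_integrable mu (fun w => f w + g w).
Proof.
move=> [fr fi] [gr gi]; split.
  by under eq_fun do rewrite scalar_reD EFinD; exact: integrableD.
by under eq_fun do rewrite scalar_imD EFinD; exact: integrableD.
Qed.

Lemma scalar_integralD f g :
  scalar_integrable mu f -> scalar_integrable mu g ->
  scalar_integral mu (fun w => f w + g w) =
  scalar_integral mu f + scalar_integral mu g.
Proof.
move=> [fr fi] [gr gi]; apply: scalar_eqP.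
  rewrite scalar_reD !scalar_re_integral -RintegralD//.
  by apply: eq_Rintegral => w _; rewrite scalar_reD.
rewrite scalar_imD !scalar_im_integral -RintegralD//.
by apply: eq_Rintegral => w _; rewrite scalar_imD.
Qed.

Lemma scalar_integrableZ c f : scalar_integrable mu f ->
  scalar_integrable mu (fun w => c * f w).
Proof.
move=> [fr fi]; split.
  under eq_fun do rewrite scalar_reM EFinB !EFinM.
  by apply: integrableB => //; exact: integrableZl.
under eq_fun do rewrite scalar_imM EFinD !EFinM.
by apply: integrableD => //; exact: integrableZl.
Qed.

Lemma integrable_EFinZl (a : R) (g : Omega -> R) :
  mu.-integrable setT (EFin \o g) ->
  mu.-integrable setT (EFin \o (fun w => a * g w)).
Proof.
move=> gi; rewrite /comp; under eq_fun do rewrite EFinM.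
exact: integrableZl.
Qed.

Lemma scalar_integralZ c f : scalar_integrable mu f ->
  scalar_integral mu (fun w => c * f w) = c * scalar_integral mu f.
Proof.
move=> [fr fi]; apply: scalar_eqP.
  rewrite scalar_reM !(scalar_re_integral, scalar_im_integral) -!RintegralZl//.
  rewrite -RintegralB//; [|exact: integrable_EFinZl|exact: integrable_EFinZl].
  by apply: eq_Rintegral => w _; rewrite scalar_reM.
rewrite scalar_imM !(scalar_re_integral, scalar_im_integral) -!RintegralZl//.
rewrite -RintegralD//; [|exact: integrable_EFinZl|exact: integrable_EFinZl].
by apply: eq_Rintegral => w _; rewrite scalar_imM.
Qed.

Lemma scalar_integrableB f g :
  scalar_integrable mu f -> scalar_integrable mu g ->
  scalar_integrable mu (fun w => f w - g w).
Proof.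
move=> fint gint; under eq_fun do rewrite -mulN1r.
by apply: scalar_integrableD => //; exact: scalar_integrableZ.
Qed.

Lemma scalar_integralB f g :
  scalar_integrable mu f -> scalar_integrable mu g ->
  scalar_integral mu (fun w => f w - g w) =
  scalar_integral mu f - scalar_integral mu g.
Proof.
move=> fint gint; under eq_fun do rewrite -mulN1r.
rewrite scalar_integralD//; last exact: scalar_integrableZ.
by rewrite scalar_integralZ// mulN1r.
Qed.

Lemma scalar_integral0 : scalar_integral mu (fun=> 0 : scalars R s) = 0.
Proof.
by apply: scalar_eqP; rewrite ?scalar_re_integral ?scalar_im_integral
  Rintegral_cst// ?scalar_re0 ?scalar_im0 mul0r.
Qed.

Lemma scalar_integrable_sum (I : Type) (r : seq I)
    (f : I -> Omega -> scalars R s) :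
  (forall i, scalar_integrable mu (f i)) ->
  scalar_integrable mu (fun w => \sum_(i <- r) f i w).
Proof.
move=> fint; elim: r => [|i r IH].
  split; under eq_fun do rewrite big_nil ?scalar_re0 ?scalar_im0;
    exact: integrable0.
under eq_fun do rewrite big_cons.
exact: scalar_integrableD.
Qed.

Lemma scalar_integral_sum (I : Type) (r : seq I)
    (f : I -> Omega -> scalars R s) :
  (forall i, scalar_integrable mu (f i)) ->
  scalar_integral mu (fun w => \sum_(i <- r) f i w) =
  \sum_(i <- r) scalar_integral mu (f i).
Proof.
move=> fint; elim: r => [|i r IH].
  by under eq_fun do rewrite big_nil; rewrite big_nil scalar_integral0.
under eq_fun do rewrite big_cons.
by rewrite big_cons -IH scalar_integralD//; exact: scalar_integrable_sum.
Qed.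

Lemma scalar_integral_ge0 f :
  (forall w, 0 <= f w) -> 0 <= scalar_integral mu f.
Proof.
move=> f0; apply/scalar_ge0P.
rewrite scalar_re_integral scalar_im_integral; split; last first.
  by apply: Rintegral_ge0 => w _; have /scalar_ge0P[] := f0 w.
under eq_Rintegral do rewrite (proj1 ((scalar_ge0P _).1 (f0 _))).
by rewrite Rintegral_cst// mul0r.
Qed.

End ScalarIntegral.

(** * The kernel of a feature map *)

Section FeatureKernel.
Context (d : measure_display) (Omega : measurableType d) (R : realType).
Context (mu : {measure set Omega -> \bar R}) (s : scalar_kind).
Context (X : Type) (H : hilbertType R s) (Phi : X -> Omega -> H).
Hypothesis Phi_L2 : forall x, square_integrable mu (Phi x).

Let Phi_int x x' := scalar_integrable_hdot (Phi_L2 x) (Phi_L2 x').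

Lemma feature_kernel_is_kernel : is_kernel (feature_kernel mu Phi).
Proof.
split=> [x x'|n x c].
  apply: scalar_eqP; rewrite ?scalar_re_conj ?scalar_im_conj
    ?scalar_re_integral ?scalar_im_integral.
    by apply: eq_Rintegral => w _; rewrite hdotC scalar_re_conj.
  rewrite -mulN1r -RintegralZl//; last by case: (Phi_int x x').
  by apply: eq_Rintegral => w _; rewrite hdotC scalar_im_conj mulN1r.
(* The double sum is the integral of the squared norm of v. *)
pose v w := \sum_(i < n) c i *: Phi (x i) w.
rewrite (_ : \sum_(i < n) _ = scalar_integral mu (fun w => hdot (v w) (v w))).
  by apply: scalar_integral_ge0 => w; rewrite hdot_normE exprn_ge0.
have -> : (fun w => hdot (v w) (v w)) = (fun w => \sum_(i < n) \sum_(j < n)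
    scalar_conj (c i) * c j * hdot (Phi (x j) w) (Phi (x i) w)).
  apply/funext => w; rewrite /v hdot_sumr; apply: eq_bigr => i _.
  rewrite hdot_suml; apply: eq_bigr => j _.
  by rewrite hdotZl hdotZr mulrCA mulrA.
rewrite scalar_integral_sum => [|i]; last first.
  by apply: scalar_integrable_sum => j; exact/scalar_integrableZ/Phi_int.
apply: eq_bigr => i _; rewrite scalar_integral_sum => [|j]; last first.
  exact/scalar_integrableZ/Phi_int.
by apply: eq_bigr => j _; rewrite scalar_integralZ.
Qed.

Let hdotBB x x' w : hdot (Phi x w - Phi x' w) (Phi x w - Phi x' w) =
  (hdot (Phi x w) (Phi x w) - hdot (Phi x' w) (Phi x w)) -
  (hdot (Phi x w) (Phi x' w) - hdot (Phi x' w) (Phi x' w)).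
Proof. by rewrite hdotBr !hdotBl. Qed.

Lemma integrable_feature_dist x x' :
  mu.-integrable setT (EFin \o (fun w => rnorm (Phi x w - Phi x' w) ^+ 2)).
Proof.
rewrite /comp; under eq_fun do rewrite -scalar_re_hdotE hdotBB.
by have [] := scalar_integrableB
  (scalar_integrableB (Phi_int x x) (Phi_int x' x))
  (scalar_integrableB (Phi_int x x') (Phi_int x' x')).
Qed.

(** The distance in the RKHS of the sections of the kernel at [x] and [x'] is the
    [L^2] distance of their features. *)
Lemma rkhs_section_dist (Hk : rkhs (feature_kernel mu Phi)) (x x' : X)
    (kx kx' : Hk) :
  rkhs_fun kx = feature_kernel mu Phi ^~ x ->
  rkhs_fun kx' = feature_kernel mu Phi ^~ x' ->
  (forall f, rkhs_fun f x = hdot f kx) ->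
  (forall f, rkhs_fun f x' = hdot f kx') ->
  rnorm (kx - kx') ^+ 2 = \int[mu]_w (rnorm (Phi x w - Phi x' w) ^+ 2).
Proof.
move=> kxE kx'E rx rx'.
under eq_Rintegral do rewrite -scalar_re_hdotE.
rewrite -scalar_re_hdotE -scalar_re_integral; congr scalar_re.
rewrite hdotBr !hdotBl -!rx -!rx' kxE kx'E /feature_kernel.
under [X in _ = scalar_integral _ X]eq_fun do rewrite hdotBB.
by rewrite scalar_integralB ?scalar_integralB//; exact: scalar_integrableB.
Qed.

End FeatureKernel.

(** The measure is required to be finite because [fine] maps [+oo] to [0]. *)
Lemma ge0_Rintegral_le_cst (d : measure_display) (Omega : measurableType d)
    (R : realType) (mu : {finite_measure set Omega -> \bar R})
    (f : Omega -> R) (C : R) :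
  measurable_fun setT f -> (forall w, 0 <= f w) ->
  {ae mu, forall w, f w <= C} ->
  0 <= C ->
  \int[mu]_w f w <= C * fine (mu setT).
Proof.
move=> mf f0 fC C0; rewrite -Rintegral_cst// /Rintegral.
have muC : mu.-integrable setT (EFin \o (fun=> C)).
  exact: finite_measure_integrable_cst.
have le : (\int[mu]_w (f w)%:E <= \int[mu]_w C%:E)%E.
  apply: ae_ge0_le_integral => //.
  - by move=> w _; rewrite lee_fin.
  - exact/measurable_EFinP.
  - by apply: filterS fC => w fw _; rewrite lee_fin.
have fin : (\int[mu]_w C%:E)%E \is a fin_num by exact: integrable_fin_num.
have intf0 : (0 <= \int[mu]_w (f w)%:E)%E.
  by apply: integral_ge0 => w _; rewrite lee_fin.
apply: fine_le => //; rewrite ge0_fin_numE// (le_lt_trans le)//.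
by rewrite -ge0_fin_numE// (le_trans _ le).
Qed.

Unset Implicit Arguments.
Set Strict Implicit.

Theorem theorem5p5 (R : realType) (s : scalar_kind)
    (d : measure_display) (Omega : measurableType d)
    (mu : {finite_measure set Omega -> \bar R})
    (X : metricType R) (X_nonempty : [set: X] !=set0)
    (H : hilbertType R s) (Phi : X -> Omega -> H)
    (Phi_L2 : forall x : X, square_integrable mu (Phi x))
    (alpha LPhi : R) (alpha_gt0 : 0 < alpha) (LPhi_gt0 : 0 < LPhi)
    (Phi_hoelder :
      {ae mu, forall w, hoelder_continuous alpha LPhi (fun x => Phi x w)}) :
  (forall x x' : X,
     scalar_integrable mu (fun w => hdot (Phi x' w) (Phi x w))) /\
  is_kernel (feature_kernel mu Phi) /\
  (forall (Hk : rkhs (feature_kernel mu Phi)) (f : Hk),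
     @hoelder_continuous R s X (scalars R s)^o
       alpha (LPhi * Num.sqrt (fine (mu setT)) * rnorm f) (rkhs_fun f)).
Proof.
split; first by move=> x x'; exact: scalar_integrable_hdot.
split; first exact: feature_kernel_is_kernel.
move=> Hk f x x'.
have [kx kxE rx] := rkhs_reproducing Hk x.
have [kx' kx'E rx'] := rkhs_reproducing Hk x'.
rewrite rx rx' -hdotBr.
apply: le_trans (hdot_CauchySchwarz _ _) _.
set m := fine (mu setT); set D := mdist x x' `^ alpha.
(* It remains to bound the norm of kx - kx'. *)
rewrite (_ : _ * D = rnorm f * (LPhi * Num.sqrt m * D)); last by ring.
rewrite ler_wpM2l ?rnorm_ge0//.
have D0 : 0 <= D by exact: powR_ge0.
have m0 : 0 <= m by exact/fine_ge0/measure_ge0.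
rewrite -ler_sqr ?nnegrE ?rnorm_ge0 ?mulr_ge0 ?sqrtr_ge0 ?(ltW LPhi_gt0)//.
rewrite (rkhs_section_dist Phi_L2 kxE kx'E rx rx').
rewrite mulrAC exprMn sqr_sqrtr//.
have /measurable_int/measurable_EFinP mdist2 :=
  integrable_feature_dist Phi_L2 x x'.
apply: ge0_Rintegral_le_cst mdist2 _ _ (sqr_ge0 _) => [w|]; first exact: sqr_ge0.
apply: filterS Phi_hoelder => w /(_ x x') hw.
by rewrite ler_sqr ?nnegrE ?rnorm_ge0 ?mulr_ge0 ?(ltW LPhi_gt0).
Qed.
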